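(* Let $K$ be a field and let $I$ be a square-free stable ideal in $S=K[x_1,\ldots,x_n]$. Then its Stanley-Reisner complex $\mathcal{N}(I)$ is chordal.
   Context: For a monomial $u\in S$, $m(u)=\max\{i: x_i\mid u\}$. A square-free monomial ideal $I$ is square-free stable if for all square-free monomials $u\in I$ and all $i<m(u)$ with $x_i\nmid u$ one has $x_i\,(u/x_{m(u)})\in I$. The Stanley-Reisner complex of $I$ is $\mathcal{N}(I)=\{F\subseteq[n]:\prod_{i\in F}x_i\notin I\}$. A simplicial complex on $[n]=\{1,\dots,n\}$ is a set $\Gamma$ of subsets of $[n]$ (faces) closed under taking subsets. $\dim F=|F|-1$; facets are maximal faces. $d$-closure. Let $d\ge1$. $\langle[n]\rangle^{[d-1]}$ denotes the complex of all subsets of $[n]$ with at most $d$ elements. $\Delta_d(\Gamma)$ is the complex on $[n]$ such that: its $d$-dimensional faces are exactly the $d$-dimensional faces of $\Gamma$; all subsets of $[n]$ with at most $d$ elements are faces; a subset with more than $d+1$ elements is a face iff all its $(d+1)$-element subsets are faces of $\Gamma$. A complex is a $d$-closure if it equals $\Delta_d(\Sigma)$ for some complex $\Sigma$ on $[n]$. Chordality. A face is free if it is contained in a unique facet (facets are free). A simplicial face of a $d$-closure is a free face of dimension $d-1$. $\Gamma\setminus E=\{F\in\Gamma:E\not\subseteq F\}$; $\Gamma\wr_E=\Gamma$ if $E\notin\Gamma$ and $(\Gamma\setminus E)\cup\{E\}$ if $E\in\Gamma$. A simplicial order of a $d$-closure $\Gamma$ is a sequence $E_1,\dots,E_t$ of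 $(d-1)$-dimensional faces such that, for each $i\ge1$, $E_i$ is a simplicial face but not a facet of $\Gamma\wr_{E_1}\cdots\wr_{E_{i-1}}$ (which is again a $d$-closure), and $\Gamma\wr_{E_1}\cdots\wr_{E_t}=\langle[n]\rangle^{[d-1]}$. $\Gamma$ is $d$-chordal if $\Delta_d(\Gamma)=\langle[n]\rangle^{[d-1]}$ or $\Delta_d(\Gamma)$ admits a simplicial order; it is chordal if it is $d$-chordal for every $d\ge1$. *)

(* Defs.v *)
From mathcomp Require Import all_boot all_order all_algebra.
From mathcomp Require Import boolp.
From mathcomp Require Import mpoly.

Set Implicit Arguments.
Unset Strict Implicit.
Unset Printing Implicit Defensive.

Import GRing.Theory.
Local Open Scope ring_scope.

(* The variables x_1 < ... < x_n and the vertices 1 < ... < n are indexed by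
   'I_n, i.e. shifted to 0, ..., n-1. Divisibility of monomials is the pointwise
   order (_ <= _)%MM on exponents, so (U_(i) <= u)%MM means x_i | u. *)

Section Ideals.

Variables (K : fieldType) (n : nat).
Implicit Types (u : 'X_{1..n}) (I : {mpoly K[n]} -> Prop).

Definition squarefree u : Prop := forall i : 'I_n, (u i <= 1)%N.

(* The unit ideal (generated by the monomial 1) and the zero ideal (generated
   by the empty set) are allowed. *)
Definition squarefree_monomial_ideal I : Prop :=
  exists G : 'X_{1..n} -> Prop,
    (forall u, G u -> squarefree u) /\
    (forall p, I p <->
       exists s : seq ({mpoly K[n]} * 'X_{1..n}),
         (forall t, t \in s -> G t.2) /\ p = \sum_(t <- s) t.1 * 'X_[t.2]).

(* m(u) = j; for u = 1 there is no such j. *)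
Definition max_var u (j : 'I_n) : Prop :=
  (U_(j) <= u)%MM /\ forall k : 'I_n, (U_(k) <= u)%MM -> (k <= j)%N.

Definition squarefree_stable I : Prop :=
  squarefree_monomial_ideal I /\
  forall u (i j : 'I_n),
    squarefree u -> I 'X_[u] -> max_var u j ->
    (i < j)%N -> ~~ (U_(i) <= u)%MM ->
    I 'X_[(U_(i) + (u - U_(j)))%MM].

Definition stanley_reisner I : {set {set 'I_n}} :=
  [set F : {set 'I_n} | `[< ~ I (\prod_(i in F) 'X_i) >]].

End Ideals.

Section Chordality.

Variable n : nat.
Implicit Types (G : {set {set 'I_n}}) (E F : {set 'I_n}) (d : nat).

(* The void complex set0 counts as a complex: it is the Stanley-Reisner complex
   of the unit ideal. *)
Definition is_complex G : Prop :=
  forall F E, F \in G -> E \subset F -> E \in G.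

(* A face of dimension k is a face with k + 1 elements. *)

Definition skeleton d : {set {set 'I_n}} := [set F : {set 'I_n} | (#|F| <= d)%N].

Definition dclosure d G : {set {set 'I_n}} :=
  [set F : {set 'I_n} |
    if (#|F| <= d)%N then true
    else if #|F| == d.+1 then F \in G
    else [forall H : {set 'I_n}, (H \subset F) && (#|H| == d.+1) ==> (H \in G)]].

Definition is_dclosure d G : Prop :=
  exists Sigma : {set {set 'I_n}}, is_complex Sigma /\ G = dclosure d Sigma.

Definition facet G F : bool := maxset [pred H : {set 'I_n} | H \in G] F.

Definition free_face G E : Prop :=
  E \in G /\ exists! F : {set 'I_n}, facet G F /\ E \subset F.

Definition simplicial_face d G E : Prop :=
  [/\ is_dclosure d G, free_face G E & #|E| = d].

Definition deletion G E : {set {set 'I_n}} := [set F in G | ~~ (E \subset F)].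

Definition wr G E : {set {set 'I_n}} :=
  if E \in G then E |: deletion G E else G.

(* simplicial_order d G [:: E_1; ...; E_t] *)
Fixpoint simplicial_order d G (s : seq {set 'I_n}) : Prop :=
  match s with
  | [::] => G = skeleton d
  | E :: s' =>
      [/\ simplicial_face d G E, ~~ facet G E & simplicial_order d (wr G E) s']
  end.

Definition d_chordal d G : Prop :=
  dclosure d G = skeleton d \/
  exists s : seq {set 'I_n}, simplicial_order d (dclosure d G) s.

Definition chordal G : Prop := forall d, (1 <= d)%N -> d_chordal d G.

End Chordality.

(* Main.v *)
Require Import Defs.
From mathcomp Require Import all_boot all_order all_algebra.
From mathcomp Require Import boolp.
From mathcomp Require Import mpoly.

(** Fix [d], and call the faces with [d + 1] elements circuits; the [d]-closure
    depends on them only.  Square-free stability speaks of non-faces, and its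
    contrapositive speaks of circuits: if [H] is a circuit and [j] lies beyond
    every vertex of [H], then exchanging any vertex of [H] for [j] gives a
    circuit again ([stanley_reisner_shift_closed]).  Exchanging vertices one by
    one, every [d + 1]-subset of [H] together with all the vertices beyond [H]
    is a circuit, so that this whole set is a face of the [d]-closure
    ([shift_closed_clique]).

    Now let [m] be the least vertex which is the last vertex of a circuit, let
    [H] be a circuit with last vertex [m], and put [E = H - m].  A circuit
    [E + v] has its last vertex at or beyond [m], while [E] lies before [m],
    hence [v >= m]; conversely all [v >= m] can be added to [E] simultaneously.
    So [E] together with all [v >= m] is the only facet containing [E]
    ([simplicial_face_before_first_top]).  Removing [E] removes the circuits
    [E + v] with [v >= m], and what remains still has the exchange property: an
    exchange that produces a set containing [E] brings in a vertex [j > m],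
    which is not in [E], and therefore started from a set that already contained
    [E] ([shift_closed_deletion]).  Induction on the number of faces gives a
    simplicial order. *)

Set Implicit Arguments.
Unset Strict Implicit.
Unset Printing Implicit Defensive.

(** * The d-closure *)

Section DClosure.

Variables (n d : nat).
Implicit Types (G : {set {set 'I_n}}) (E F H T : {set 'I_n}).

(** The three cases in the definition of the closure are one condition: it is
    vacuous for [#|F| <= d], and for [#|F| = d + 1] it concerns [F] alone. *)
Lemma dclosureP G F :
  reflect (forall H, H \subset F -> #|H| = d.+1 -> H \in G)
          (F \in dclosure d G).
Proof.
rewrite inE; case: leqP => [leFd | ltdF].
  apply: ReflectT => H /subset_leq_card leHF cardH.
  by move: (leq_trans leHF leFd); rewrite cardH ltnn.
case: eqP => [cardF | _].
  apply: (iffP idP) => [FG H sHF cardH | ]; last by apply.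
  by have /eqP -> : H == F by rewrite eqEcard sHF cardF cardH leqnn.
apply: (iffP forallP) => [allG H sHF cardH | allG H].
  by have := allG H; rewrite sHF cardH eqxx.
by apply/implyP => /andP[sHF /eqP cardH]; apply: allG.
Qed.

Lemma dclosure_small G F : #|F| <= d -> F \in dclosure d G.
Proof. by rewrite inE => ->. Qed.

(** The closure is a complex and is idempotent, so it is its own witness. *)
Lemma is_dclosure_dclosure G : is_dclosure d (dclosure d G).
Proof.
exists (dclosure d G); split.
  move=> F E /dclosureP FG sEF; apply/dclosureP => H sHE.
  exact/FG/(subset_trans sHE).
apply/setP => F; apply/dclosureP/dclosureP => FG H sHF cardH.
  apply/dclosureP => T sTH; exact/FG/(subset_trans sTH).
by move/dclosureP: (FG H sHF cardH); apply.
Qed.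

Lemma dclosure_no_circuit G :
  (forall H, H \in G -> #|H| != d.+1) -> dclosure d G = skeleton n d.
Proof.
move=> noG; apply/setP => F; rewrite [RHS]inE.
apply/dclosureP/idP => [FG | leFd H sHF cardH]; last first.
  by move: (leq_trans (subset_leq_card sHF) leFd); rewrite cardH ltnn.
rewrite leqNgt; apply/negP => ltdF.
have [H /[!inE] /andP[sHF /eqP cardH]] :
  exists H, H \in [set A : {set 'I_n} | (A \subset F) && (#|A| == d.+1)].
  by apply/card_gt0P; rewrite cards_draws bin_gt0.
by move: (noG H (FG H sHF cardH)); rewrite cardH eqxx.
Qed.

Lemma wr_dclosure G E :
  #|E| = d -> wr (dclosure d G) E = dclosure d (deletion G E).
Proof.
move=> cardE; rewrite /wr dclosure_small ?cardE //; apply/setP => F.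
rewrite in_setU1 [X in _ || X]inE.
apply/idP/dclosureP => [/orP[/eqP -> | /andP[/dclosureP FG nEF]] | FG].
- move=> H /subset_leq_card; rewrite cardE => leHd cardH.
  by rewrite cardH ltnn in leHd.
- move=> H sHF cardH; rewrite inE FG //.
  by apply: contra nEF => sEH; apply: subset_trans sHF.
have -> /= : F \in dclosure d G.
  by apply/dclosureP => H sHF /(FG H sHF); rewrite inE => /andP[].
(* A proper superset of E contains some E + v, a circuit that was deleted. *)
case: eqP => //= neFE; apply/negP => sEF.
have /properP[_ [v vF vE]] : E \proper F.
  by rewrite properEneq sEF eq_sym andbT; apply/eqP.
have := FG (v |: E); rewrite subUset sub1set vF sEF cardsU1 vE cardE.
by move=> /(_ isT erefl); rewrite inE subsetUr andbF.
Qed.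

End DClosure.

(** * Families closed under exchange with a later vertex *)

Section ShiftClosed.

Variables (n d : nat).
Implicit Types (G : {set {set 'I_n}}) (E F H T : {set 'I_n}) (i j k m v : 'I_n).

Definition shift_closed G : Prop :=
  forall H i j, H \in G -> #|H| = d.+1 -> i \in H ->
    (forall k, k \in H -> k < j) -> j |: (H :\ i) \in G.

(** The vertices of [T] outside [H] are brought in one at a time.  They come in
    increasing order, so that each one lies beyond the set reached so far. *)
Lemma shift_closed_clique G H T :
    shift_closed G -> H \in G -> #|H| = d.+1 -> #|T| = d.+1 ->
    (forall v, v \in T -> v \notin H -> forall k, k \in H -> k < v) ->
  T \in G.
Proof.
move=> shG; have [c] := ubnP #|T :\: H|.
elim: c H => // c IHc H ltc HG cardH cardT beyond.
have [/eqP TH0 | /set0Pn[j0 j0TH]] := boolP (T :\: H == set0).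
  by have /eqP -> : T == H by rewrite eqEcard -setD_eq0 TH0 eqxx cardT cardH leqnn.
have [j /setDP[jT jH] minj] :=
  @arg_minnP _ j0 (fun x => x \in T :\: H) (fun x => x : nat) j0TH.
have [i iH iT] : exists2 i, i \in H & i \notin T.
  apply/subsetPn; apply: contra jH => sHT.
  by have /eqP -> : H == T by rewrite eqEcard sHT cardH cardT leqnn.
have jHi : j \notin H :\ i by rewrite !inE (negPf jH) andbF.
apply: (IHc (j |: H :\ i)) => //.
- rewrite ltnS in ltc; apply: leq_trans ltc; apply: proper_card.
  apply/properP; split.
    apply/subsetP => v; rewrite !inE negb_or negb_and negbK.
    case/andP => /andP[_ /orP[/eqP -> | ->]] // vT.
    by rewrite vT in iT.
  by exists j; rewrite !inE ?eqxx ?jT ?jH.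
- by apply: shG => // k; apply: beyond.
- by rewrite cardsU1 jHi; move: cardH; rewrite (cardsD1 i) iH.
- move=> v vT; rewrite !inE negb_or negb_and negbK => /andP[nvj nvH] k.
  have vH : v \notin H.
    by case/orP: nvH => // /eqP vi; rewrite -vi vT in iT.
  rewrite !inE => /orP[/eqP -> | /andP[_ kH]]; last exact: beyond.
  have lejv : j <= v by apply: minj; rewrite !inE vH.
  by rewrite ltn_neqAle lejv andbT eq_sym.
Qed.

(** So [m] is the least of the last vertices of circuits; minimality is put as
    the presence of a late vertex in every circuit, which avoids naming the last
    vertex of each. *)
Definition before_first_top G E m : Prop :=
  [/\ #|E| = d, forall k, k \in E -> k < m, m |: E \in G &
      forall H, H \in G -> #|H| = d.+1 -> exists2 k, k \in H & m <= k].

Lemma before_first_top_exists G H0 :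
  H0 \in G -> #|H0| = d.+1 -> exists E m, before_first_top G E m.
Proof.
move=> H0G cardH0.
pose is_top m := [exists H, [&& H \in G, #|H| == d.+1, m \in H &
                               [forall k in H, k <= m]]].
have top_of H : H \in G -> #|H| = d.+1 -> exists2 m, m \in H & is_top m.
  move=> HG cardH; have /card_gt0P[x xH] : 0 < #|H| by rewrite cardH.
  have [m mH maxm] :=
    @arg_maxnP _ x (fun y => y \in H) (fun y => y : nat) xH.
  exists m => //; apply/existsP; exists H; rewrite HG cardH eqxx mH /=.
  by apply/forall_inP => k; apply: maxm.
have [m0 _ top0] := top_of H0 H0G cardH0.
have [m /existsP[H /and4P[HG /eqP cardH mH /forall_inP maxm]] minm] :=
  @arg_minnP _ m0 is_top (fun y => y : nat) top0.
exists (H :\ m), m; split.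
- by move: cardH; rewrite (cardsD1 m) mH => -[].
- by move=> k /setD1P[nkm kH]; rewrite ltn_neqAle maxm // andbT.
- by rewrite setD1K.
- by move=> F FG cardF; have [k kF /minm] := top_of F FG cardF; exists k.
Qed.

Section FirstTop.

Variables (G : {set {set 'I_n}}) (E : {set 'I_n}) (m : 'I_n).
Hypotheses (shG : shift_closed G) (topE : before_first_top G E m).

Let card_top : #|m |: E| = d.+1.
Proof.
case: topE => cardE ltEm _ _; rewrite cardsU1 cardE.
by have -> : m \notin E by apply/negP => /ltEm; rewrite ltnn.
Qed.

Let star : {set 'I_n} := E :|: [set v : 'I_n | m <= v].

Lemma star_in_dclosure : star \in dclosure d G.
Proof.
case: topE => cardE ltEm HG _; apply/dclosureP => T sT cardT.
apply: (shift_closed_clique shG HG) => // v /(subsetP sT).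
rewrite !inE negb_or => /orP[-> /[!andbF] // | lemv] /andP[nvm _] k.
have ltmv : m < v by rewrite ltn_neqAle lemv andbT eq_sym.
by rewrite !inE => /orP[/eqP -> // | /ltEm ltkm]; apply: ltn_trans ltmv.
Qed.

Lemma dclosure_sub_star F : F \in dclosure d G -> E \subset F -> F \subset star.
Proof.
case: topE => cardE ltEm _ minm /dclosureP FG sEF.
apply/subsetP => v vF; rewrite !inE; case: (boolP (v \in E)) => //= vE.
have [||k] := minm (v |: E).
- by apply: FG; rewrite ?subUset ?sub1set ?vF // cardsU1 vE cardE.
- by rewrite cardsU1 vE cardE.
rewrite !inE => /orP[/eqP -> // | /ltEm ltkm] lemk.
by move: (leq_trans ltkm lemk); rewrite ltnn.
Qed.

Lemma simplicial_face_before_first_top : simplicial_face d (dclosure d G) E.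
Proof.
case: (topE) => cardE _ _ _; split=> //; first exact: is_dclosure_dclosure.
split; first by rewrite dclosure_small ?cardE.
exists star; split=> [|F [/maxsetP[FG maxF] sEF]].
  split; last exact: subsetUl.
  apply/maxsetP; split=> [|F FG sSF]; first exact: star_in_dclosure.
  apply/eqP; rewrite eqEsubset sSF dclosure_sub_star //.
  by apply: subset_trans sSF; apply: subsetUl.
by apply: maxF; rewrite ?dclosure_sub_star //; apply: star_in_dclosure.
Qed.

Lemma before_first_top_not_facet : ~~ facet (dclosure d G) E.
Proof.
case: (topE) => _ ltEm _ _; apply/negP => /maxsetP[_ maxE].
have mE : m \in E.
  rewrite -(maxE star) ?subsetUl //; first by rewrite !inE leqnn orbT.
  exact: star_in_dclosure.
by have := ltEm m mE; rewrite ltnn.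
Qed.

(** Every circuit has a vertex [k >= m], so the new vertex [j] of an exchange is
    beyond [m] and outside [E]: the exchange cannot complete a copy of [E]. *)
Lemma shift_closed_deletion : shift_closed (deletion G E).
Proof.
case: topE => _ ltEm _ minm H i j /[!inE] /andP[HG nEH] cardH iH beyond.
rewrite shG //=; apply: contra nEH => sE.
have [k kH lemk] := minm H HG cardH.
have ltmj : m < j by apply: leq_ltn_trans (beyond k kH).
apply/subsetP => v vE; have := subsetP sE v vE.
rewrite !inE => /orP[/eqP vj | /andP[_ //]].
by move: (ltn_trans (ltEm v vE) ltmj); rewrite vj ltnn.
Qed.

End FirstTop.

Lemma shift_closed_simplicial_order G :
  shift_closed G -> exists s, simplicial_order d (dclosure d G) s.
Proof.
have [c] := ubnP #|G|; elim: c G => // c IHc G ltGc shG.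
have [/exists_inP[H HG /eqP cardH] | noG] :=
  boolP [exists H in G, #|H| == d.+1]; last first.
  by exists [::]; apply: dclosure_no_circuit => H; move/exists_inPn: noG; apply.
have [E [m topE]] := before_first_top_exists HG cardH.
have [cardE _ mEG _] := topE.
have [|s ords] := IHc (deletion G E) _ (shift_closed_deletion shG topE).
  rewrite ltnS in ltGc; apply: leq_trans ltGc; apply: proper_card.
  apply/properP; split; first by apply/subsetP => F /[!inE] /andP[].
  by exists (m |: E); rewrite // inE subsetUr andbF.
exists (E :: s); split.
- exact: simplicial_face_before_first_top topE.
- exact: before_first_top_not_facet topE.
- by rewrite wr_dclosure.
Qed.

End ShiftClosed.

(** * Square-free stable ideals *)

Section Ideals.

Variables (K : fieldType) (n : nat) (I : {mpoly K[n]} -> Prop).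

Definition set_mnm (F : {set 'I_n}) : 'X_{1..n} := [multinom (i \in F : nat) | i < n].

Lemma prod_mpolyX_set (F : {set 'I_n}) :
  (\prod_(i in F) 'X_i = 'X_[set_mnm F] :> {mpoly K[n]})%R.
Proof.
rewrite [RHS]mpolyXE_id [RHS](bigID (fun i => i \in F)) /=.
rewrite [X in (_ * X)%R]big1 ?GRing.mulr1 => [|i iF].
  by apply: eq_bigr => i iF; rewrite mnmE iF GRing.expr1.
by rewrite mnmE (negPf iF) GRing.expr0.
Qed.

Lemma mnm1_le_set (F : {set 'I_n}) i : (U_(i) <= set_mnm F)%MM = (i \in F).
Proof.
apply/mnm_lepP/idP => [/(_ i) | iF k]; rewrite mnm1E mnmE.
  by rewrite eqxx; case: (i \in F).
by case: eqP => // <-; rewrite iF.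
Qed.

(** Read backwards, the exchange [H - i + j] is the step in the definition of
    stability: [j] is the last vertex of [H - i + j], and replacing it by the
    earlier [i] gives [H].  So [H] is a non-face whenever [H - i + j] is. *)
Lemma stanley_reisner_shift_closed d :
  squarefree_stable I -> shift_closed d (stanley_reisner I).
Proof.
case=> _ stable H i j; rewrite !inE => /asboolP HI _ iH beyond.
have ltij := beyond i iH.
have nij : (i == j) = false by rewrite -val_eqE (ltn_eqF ltij).
have jH : j \notin H by apply/negP => /beyond; rewrite ltnn.
apply/asboolP; set F := j |: H :\ i => FI; apply: HI.
rewrite prod_mpolyX_set in FI.
have iF : i \notin F by rewrite !inE eqxx nij.
have -> : (\prod_(k in H) 'X_k)%R =
          ('X_[(U_(i) + (set_mnm F - U_(j)))%MM] : {mpoly K[n]}).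
  rewrite prod_mpolyX_set; congr ('X_[_])%R; apply/mnmP => k.
  rewrite !(mnmDE, mnmBE, mnmE, mnm1E) !inE [i == k]eq_sym [j == k]eq_sym.
  have [-> | _] := eqVneq k i; first by rewrite iH nij.
  by have [-> | _] := eqVneq k j; rewrite ?(negPf jH) // subn0.
apply: stable => //.
- by move=> k; rewrite mnmE; case: (k \in F).
- split=> [|k]; rewrite mnm1_le_set !inE ?eqxx //.
  by case/orP => [/eqP -> // | /andP[_ /beyond /ltnW]].
- by rewrite mnm1_le_set.
Qed.

End Ideals.

Theorem theorem5p3 (K : fieldType) (n : nat) (I : {mpoly K[n]} -> Prop)
  (hI : squarefree_stable I) :
  chordal (stanley_reisner I).
Proof.
move=> d _; right; apply: shift_closed_simplicial_order.
exact: stanley_reisner_shift_closed.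
Qed.
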